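(* For every integer $n \geq 0$, $$L_n^{(-1)}(x) = \frac{1}{n!} \sum_{k=0}^{n} L(n,k)\, (-x)^k ,$$ where $L_n^{(-1)}(x)$ is the Laguerre polynomial of order $-1$ and $L(n,k)$ are the Lah numbers.
   Context: The Lah numbers are $L(n,k) = \frac{n!}{k!}\binom{n-1}{k-1}$ for $1 \leq k \leq n$, with $L(0,0)=1$ and $L(n,0)=0$ for $n \geq 1$; equivalently, $\frac{1}{k!}\left(\frac{t}{1-t}\right)^k = \sum_{n=k}^{\infty} L(n,k) \frac{t^n}{n!}$ for each $k\ge 0$. The Laguerre polynomials of order $-1$, $L_n^{(-1)}(x)$, $n = 0,1,2,\ldots$, are defined by the generating function $$e^{\frac{-xt}{1-t}} = \sum_{n=0}^{\infty} L_n^{(-1)}(x)\, t^n, \quad |t|<1,$$ or, equivalently, by the Rodrigues formula $L_n^{(-1)}(x) = \frac{x e^x}{n!} \frac{d^n}{dx^n}\left(e^{-x} x^{n-1}\right)$. *)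

(* Defs.v *)
From HB Require Import structures.
From mathcomp Require Import all_boot all_order all_algebra.
From mathcomp Require Import all_classical all_reals all_analysis.

Set Implicit Arguments.
Unset Strict Implicit.
Unset Printing Implicit Defensive.

Import Order.TTheory GRing.Theory Num.Theory.
Import numFieldNormedType.Exports.

Local Open Scope classical_set_scope.
Local Open Scope ring_scope.

(* For 1 <= k <= n, k! divides n!, so the Euclidean quotient is exact; for
   1 <= n < k it is 0, giving the usual convention L(n,k) = 0. *)
Definition lah (n k : nat) : nat :=
  match n, k with
  | 0, 0 => 1
  | n'.+1, k'.+1 => n`! %/ k`! * 'C(n', k')
  | _, _ => 0
  end%N.

Definition laguerreN1_genfun (R : realType) (L : nat -> {poly R}) : Prop :=
  forall x t : R, `|t| < 1 ->
    series (fun n : nat => (L n).[x] * t ^+ n) @ \oo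
      --> expR (- (x * t) / (1 - t)).

(* The Laguerre polynomials of order -1: the family of polynomials with this
   generating function.  Existence of the family is not built in; were there
   none, [xget] would return the zero family. *)
Definition laguerreN1 (R : realType) : nat -> {poly R} :=
  xget (fun=> 0) [set L : nat -> {poly R} | laguerreN1_genfun L].

(* Main.v *)
(* Dividing by n!, the claim is that exp(-xt/(1-t)) has t^n-coefficient
   sum_k c(n,k) (-x)^k / k!, where c(n,k) = (k!/n!) L(n,k) counts the
   compositions of n into k positive parts.  The rule
   c(n+1,k+1) = c(n,k+1) + c(n,k) gives sum_n c(n,k) t^n = (t/(1-t))^k, with
   partial sums bounded by (|t|/(1-|t|))^k; this domination allows the limit
   N -> oo to be taken inside the sum over k (Tannery), which yields the
   exponential series.  The coefficients of a power series are determined by its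
   sum near 0, so no other family has this generating function. *)
Require Import Defs.
From HB Require Import structures.
From mathcomp Require Import all_boot all_order all_algebra.
From mathcomp Require Import all_classical all_reals all_analysis.
From mathcomp Require Import ring lra.

Set Implicit Arguments.
Unset Strict Implicit.
Unset Printing Implicit Defensive.

Import Order.TTheory GRing.Theory Num.Theory.
Import numFieldNormedType.Exports.

Local Open Scope ring_scope.

(** * Limits of dominated series, and uniqueness of power series coefficients *)

Section Series.
Context {R : realType}.
Local Open Scope classical_set_scope.

(** Cut at a [K] where the tail of [series M] is at most [e / 2]: the first [K] terms form a fixed
    finite sum of null sequences, and the terms from [K] to the moving end [N] stay below that
    tail. *)
Lemma series_dominated_cvg0 (f : nat -> nat -> R) (M : nat -> R) :
    (forall N k, `|f N k| <= M k) -> cvgn (series M) ->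
    (forall k, f N k @[N --> \oo] --> 0) ->
  series (f N) N @[N --> \oo] --> 0.
Proof.
move=> fM cM f0; apply/cvgrPdist_le => e e0.
have M0 k : 0 <= M k by apply: le_trans (fM 0%N k).
have ndM : nondecreasing_seq (series M) by apply: nondecreasing_series.
have [K _ MK] : \forall n \near \oo, `|limn (series M) - series M n| <= e / 2.
  by move/cvgrPdist_le: cM; apply; rewrite divr_gt0.
have : \sum_(0 <= k < K) `|f N k| @[N --> \oo] --> \sum_(0 <= k < K) (0 : R).
  apply: cvg_big => [|k _]; first exact: add_continuous.
  by rewrite -(@normr0 _ R); apply: cvg_norm.
rewrite big1// => /cvgrPdist_le/(_ (e / 2)); rewrite divr_gt0// => /(_ isT) sK.
near=> N.
have KN : (K <= N)%N by near: N; exact: nbhs_infty_ge.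
rewrite sub0r normrN /series /= (le_trans (ler_norm_sum _ _ _))//.
rewrite (big_cat_nat (leq0n K) KN)//= (splitr e) lerD//.
  rewrite (le_trans (ler_norm _))// -normrN -sub0r.
  by near: N.
apply: (@le_trans _ _ (\sum_(K <= k < N) M k)); first exact: ler_sum.
rewrite -sub_series_geq//.
have := MK K (leqnn K); rewrite /= => /(le_trans (ler_norm _)); apply: le_trans.
by rewrite lerB// nondecreasing_cvgn_le.
Unshelve. all: by end_near. Qed.

(* Tannery's theorem, here with the number of summands growing with N. *)
Lemma series_dominated_cvg (f : nat -> nat -> R) (g M : nat -> R) :
    (forall N k, `|f N k| <= M k) -> cvgn (series M) ->
    (forall k, f N k @[N --> \oo] --> g k) ->
  series (f N) N @[N --> \oo] --> limn (series g).
Proof.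
move=> fM cM fg.
have gM k : `|g k| <= M k.
  apply: (cvgr_to_le (cvg_norm (fg k))).
  by near=> N.
have cg : cvgn (series g).
  apply: normed_cvg; apply: (series_le_cvg _ _ gM cM) => k //.
  exact: le_trans (gM k).
have c0 : series (fun k => f N k - g k) N @[N --> \oo] --> 0.
  apply: (@series_dominated_cvg0 _ (fun k => M k + M k)) => [N k||k].
  - by rewrite (le_trans (ler_normB _ _))// lerD.
  - exact: (is_cvg_seriesD cM cM).
  - by rewrite -(subrr (g k)); apply: cvgB => //; exact: cvg_cst.
rewrite -[limn _]add0r.
have -> : (fun N => series (f N) N) =
    (fun N => series (fun k => f N k - g k) N + series g N).
  by apply/funext => N; rewrite /series /= sumrB subrK.
exact: cvgD c0 cg.
Unshelve. all: by end_near. Qed.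

Lemma sum_expr_half_le (y : R) m N : 0 <= y <= 2^-1 -> (m <= N)%N ->
  \sum_(m <= i < N) y ^+ i <= 2 * y ^+ m.
Proof.
move=> /andP[y0 y2] mN.
(* The extra term makes the induction on [N] close, since [y <= 2^-1] gives
   [y ^+ N + 2 * y ^+ N.+1 <= 2 * y ^+ N]. *)
suff : \sum_(m <= i < N) y ^+ i + 2 * y ^+ N <= 2 * y ^+ m.
  by apply: le_trans; rewrite lerDl mulr_ge0// exprn_ge0.
elim: N mN => [|N IH]; first by rewrite leqn0 => /eqP->; rewrite big_geq// add0r.
rewrite leq_eqVlt => /orP[/eqP->|]; first by rewrite big_geq// add0r.
rewrite ltnS => mN; rewrite big_nat_recr//=; apply: le_trans (IH mN).
rewrite -addrA lerD2l exprS; have : 0 <= y ^+ N by rewrite exprn_ge0.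
by nra.
Qed.

Lemma pseries_eq0 (c : nat -> R) :
  (forall t : R, `|t| < 1 -> pseries c t @ \oo --> 0) -> forall n, c n = 0.
Proof.
move=> c0 m; elim/ltn_ind: m => m IH.
(* The terms of the convergent series at [t = 2^-1] are bounded. *)
have [B B0 cB] : exists2 B, 0 < B & forall n, `|c n| <= B * 2 ^+ n.
  have /cvg_series_bounded[B [_ cB]] : cvgn (pseries c 2^-1).
    by apply: cvgP (c0 _ _); rewrite ger0_norm ?invr_ge0// invf_lt1// ltr1n.
  exists (`|B| + 1); first by rewrite ltr_wpDl.
  move=> n; have := cB (`|B| + 1); rewrite ltr_pwDr ?ler_norm// => /(_ isT n I).
  by rewrite /= normrM normrX (@ger0_norm _ 2^-1)// exprVn ler_pdivrMr// exprn_gt0.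
(* The terms of index > m sum to O(t^(m+1)), so c_m t^m is O(t^(m+1)) too. *)
have bound t : 0 < t -> t <= 4^-1 -> `|c m| <= 4 * B * 2 ^+ m * t.
  move=> t0 t4.
  have t1 : `|t| < 1 by rewrite ger0_norm; lra.
  have tail N : (m < N)%N ->
      `|c m| * t ^+ m - 2 * B * (2 * t) ^+ m.+1 <= `|pseries c t N|.
    move=> mN; rewrite /pseries/series/= (big_cat_nat (leq0n m) (ltnW mN))//=.
    rewrite big_nat big1 ?add0r; last by move=> i /andP[_ /IH->]; rewrite mul0r.
    rewrite big_ltn//; apply: le_trans (lerB_normD _ _).
    rewrite normrM normrX (gtr0_norm t0) lerD2l lerN2.
    rewrite (le_trans (ler_norm_sum _ _ _))//.
    apply: (@le_trans _ _ (\sum_(m.+1 <= i < N) B * (2 * t) ^+ i)).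
      apply: ler_sum => i _; rewrite normrM normrX (gtr0_norm t0) exprMn mulrA.
      by rewrite ler_wpM2r// exprn_ge0// ltW.
    (* The bound [t <= 4^-1] keeps the ratio [2 * t] at most [2^-1]. *)
    rewrite -mulr_sumr [2 * B]mulrC -mulrA ler_pM2l// sum_expr_half_le//.
    by apply/andP; split; lra.
  have : `|c m| * t ^+ m - 2 * B * (2 * t) ^+ m.+1 <= 0.
    rewrite -(@normr0 _ R); apply: (cvgr_to_ge (cvg_norm (c0 t t1))).
    by near=> N; apply: tail; near: N; exact: nbhs_infty_gt.
  rewrite subr_le0 exprMn => h.
  rewrite -(@ler_pM2r _ (t ^+ m)) ?exprn_gt0//; apply: le_trans h _.
  by rewrite !exprS le_eqVlt; apply/orP; left; apply/eqP; ring.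
apply/eqP; rewrite -normr_le0 leNgt; apply/negP => cm0.
pose D := 4 * B * 2 ^+ m.
have D0 : 0 < D by rewrite !mulr_gt0// exprn_gt0.
(* Small enough for [bound] to apply and for [D * t] to be at most half of [|c m|], which
   contradicts [bound]. *)
pose t := Num.min 4^-1 (`|c m| / (2 * D)).
have t0 : 0 < t by rewrite lt_min invr_gt0 ltr0n divr_gt0 ?mulr_gt0.
have := bound t t0; rewrite ge_min lexx => /(_ isT) h.
have : D * t <= `|c m| / 2.
  rewrite mulrC -ler_pdivlMr// -mulrA -invfM ge_min lexx orbT//.
by move: h; rewrite -/D; lra.
Unshelve. all: by end_near. Qed.

End Series.

(** * Compositions and Lah numbers *)

Definition ncompositions (n k : nat) : nat :=
  match n, k with
  | 0, 0 => 1
  | n'.+1, k'.+1 => 'C(n', k')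
  | _, _ => 0
  end%N.

(** Pascal's rule; on compositions, decrease the last part if it exceeds 1, and delete it
    otherwise. *)
Lemma ncompositionsSS n k :
  ncompositions n.+1 k.+1 = (ncompositions n k.+1 + ncompositions n k)%N.
Proof. by case: n k => [|n] [|k] //=; rewrite ?bin0 // binS. Qed.

Lemma ncompositions_small n k : (n < k)%N -> ncompositions n k = 0%N.
Proof. by case: n k => [|n] [|k] //=; rewrite ltnS => /bin_small. Qed.

(** For [k <= n] the quotient in [lah] is exact, by the factorial formula for binomials; for [k > n]
    the binomial vanishes. *)
Lemma lah_ncompositions n k : (lah n k * k`! = ncompositions n k * n`!)%N.
Proof.
case: n k => [|n] [|k] //=.
have [nk|kn] := ltnP n k; first by rewrite bin_small// !muln0.
rewrite mulnAC divnK; first by rewrite mulnC.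
by rewrite -(@bin_fact n.+1 k.+1)// dvdn_mull// dvdn_mulr.
Qed.

Arguments ncompositions : simpl never.

(** * Generating functions of compositions, then of the Lah polynomials *)

Section GeneratingFunction.
Context {R : realType}.
Local Open Scope classical_set_scope.

Let A (t : R) (k : nat) := pseries (fun n => (ncompositions n k)%:R) t.

Let A0 t N : A t 0 N.+1 = 1.
Proof.
rewrite /A/pseries/series/= big_nat_recl//= mul1r big1 ?addr0// => i _.
by rewrite mul0r.
Qed.

Let AS t k N : A t k.+1 N.+1 = t * (A t k.+1 N + A t k N).
Proof.
rewrite /A/pseries/series/= big_nat_recl// ncompositions_small// mul0r add0r
  -big_split/= mulr_sumr.
by apply: eq_bigr => i _; rewrite ncompositionsSS natrD exprS; ring.
Qed.

(** Induction on [N] through [AS]: the bound reproduces itself because [r = t / (1 - t)] satisfies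
    [t * (r ^+ k.+1 + r ^+ k) = r ^+ k.+1]. *)
Let A_le t k N : 0 <= t < 1 -> A t k N <= (t / (1 - t)) ^+ k.
Proof.
move=> /andP[t0 t1]; have r0 : 0 <= t / (1 - t) by rewrite divr_ge0// subr_ge0 ltW.
elim: N k => [|N IH] [|k].
- by rewrite /A/pseries/series/= big_geq.
- by rewrite /A/pseries/series/= big_geq// exprn_ge0.
- by rewrite A0.
- rewrite AS; apply: le_trans (ler_wpM2l t0 (lerD (IH _) (IH _))) _.
  rewrite exprS le_eqVlt; apply/orP; left; apply/eqP; field.
  by rewrite subr_eq0 gt_eqF.
Qed.

Lemma norm_pseries_ncompositions (t : R) k N : `|t| < 1 ->
  `|pseries (fun n => (ncompositions n k)%:R) t N| <= (`|t| / (1 - `|t|)) ^+ k.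
Proof.
move=> t1; apply: le_trans (A_le k N _); last by rewrite normr_ge0.
rewrite /A /pseries /series /= (le_trans (ler_norm_sum _ _ _))//.
by apply: ler_sum => i _; rewrite normrM normrX normr_nat.
Qed.

Lemma cvg_pseries_ncompositions (t : R) k : `|t| < 1 ->
  pseries (fun n => (ncompositions n k)%:R) t @ \oo --> (t / (1 - t)) ^+ k.
Proof.
move=> t1; have t10 : 1 - t != 0.
  by rewrite subr_eq0 eq_sym lt_eqF// (le_lt_trans (ler_norm _)).
elim: k => [|k IH]; rewrite -/(A t _).
  (* The shift skips the empty partial sum, which is 0 instead of 1. *)
  rewrite -cvg_shiftS expr0 (_ : (fun n => _) = cst 1); first exact: cvg_cst.
  by apply/funext => n /=; exact: A0.
have cA : cvgn (A t k.+1).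
  apply: normed_cvg; apply: nondecreasing_is_cvgn.
    by apply: nondecreasing_series => i _ _; exact: normr_ge0.
  exists ((`|t| / (1 - `|t|)) ^+ k.+1) => _ [N _ <-].
  apply: le_trans (A_le _ N _); last by rewrite normr_ge0.
  rewrite /A /pseries /series /=; apply: ler_sum => i _.
  by rewrite normrM normrX normr_nat.
(* With convergence known, [AS] passes to the limit and becomes a linear equation for it, solvable
   because [1 - t] is nonzero. *)
have : A t k.+1 N.+1 @[N --> \oo] --> t * (limn (A t k.+1) + (t / (1 - t)) ^+ k).
  under eq_fun do rewrite AS.
  by apply: cvgMl_tmp; apply: cvgD.
rewrite (cvg_shiftS (A t k.+1)) => h.
have /= e := cvg_unique (@norm_hausdorff _ _) cA h.
have -> // : (t / (1 - t)) ^+ k.+1 = limn (A t k.+1).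
rewrite exprS; apply: (mulfI t10); rewrite [RHS]mulrBl mul1r {1}e.
generalize ((t / (1 - t)) ^+ k) => r; by field.
Qed.

Definition lah_poly (n : nat) : {poly R} :=
  (n`!%:R)^-1 *: \sum_(0 <= k < n.+1) (lah n k)%:R *: (- 'X) ^+ k.

(** A bound [N] common to all [n < N] makes the double sum run over a square, ready for exchanging
    the summations. *)
Lemma horner_lah_poly n (x : R) N : (n < N)%N ->
  (lah_poly n).[x] = \sum_(0 <= k < N) (ncompositions n k)%:R * exp_coeff (- x) k.
Proof.
move=> nN; rewrite [RHS](big_cat_nat (leq0n n.+1) nN)//=.
rewrite [X in _ + X]big1_seq => [|k]; last first.
  rewrite mem_index_iota => /andP[_ /andP[/ncompositions_small-> _]].
  by rewrite mul0r.
rewrite addr0 /lah_poly hornerZ horner_sum mulr_sumr; apply: eq_bigr => k _.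
rewrite hornerZ horner_exp hornerN hornerX /exp_coeff/=.
have f0 j : (j`!%:R : R) != 0 by rewrite pnatr_eq0 -lt0n fact_gt0.
have : (lah n k)%:R * k`!%:R = (ncompositions n k)%:R * n`!%:R :> R.
  by rewrite -!natrM lah_ncompositions.
move=> h; apply: (mulfI (f0 n)); apply: (mulIf (f0 k)).
transitivity ((lah n k)%:R * k`!%:R * (- x) ^+ k); first by field.
by rewrite h; field.
Qed.

Lemma lah_poly_genfun : laguerreN1_genfun lah_poly.
Proof.
move=> x t t1; pose f N k := A t k N * exp_coeff (- x) k.
have -> : series (fun n => (lah_poly n).[x] * t ^+ n) = (fun N => series (f N) N).
  apply/funext => N; rewrite /series /= /f /A /pseries /series /=.
  under [RHS]eq_bigr do rewrite mulr_suml.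
  rewrite exchange_big_nat/=; apply: eq_big_nat => n /andP[_ nN].
  by rewrite (horner_lah_poly _ nN) mulr_suml; apply: eq_bigr => k _; ring.
(* [expR] is by definition the limit of [series (exp_coeff _)], and the dominating series is again
   exponential. *)
apply: (@series_dominated_cvg _ _ _ (exp_coeff (`|t| / (1 - `|t|) * `|x|))).
- move=> N k; rewrite /f /exp_coeff /= exprMn -mulrA normrM.
  apply: ler_pM => //; first exact: norm_pseries_ncompositions.
  by rewrite normrM normrX normrN normfV normr_nat.
- exact: is_cvg_series_exp_coeff.
- move=> k; rewrite /f /exp_coeff /= -mulNr.
  rewrite (_ : - x * t / _ = t / (1 - t) * - x); last by ring.
  rewrite exprMn -mulrA.
  by apply: cvgMr_tmp; exact: cvg_pseries_ncompositions.
Qed.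

Lemma horner_inj (p q : {poly R}) : (forall x, p.[x] = q.[x]) -> p = q.
Proof.
move=> pq; apply/eqP; rewrite -subr_eq0; apply/eqP.
(* The naturals below [size (p - q)] are distinct in [R], and they are too many roots for a nonzero
   [p - q]. *)
apply: (@roots_geq_poly_eq0 _ _ [seq i%:R | i <- iota 0 (size (p - q))]).
- by apply/allP => x _; rewrite /root hornerD hornerN pq subrr.
- by rewrite map_inj_uniq ?iota_uniq// => i j /eqP; rewrite eqr_nat => /eqP.
- by rewrite size_map size_iota.
Qed.

(** With [x] fixed, the difference of the two expansions is a power series in [t] with sum 0; hence
    [L n] and [L' n] agree at every [x]. *)
Lemma laguerreN1_genfun_unique (L L' : nat -> {poly R}) :
  laguerreN1_genfun L -> laguerreN1_genfun L' -> L = L'.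
Proof.
move=> gL gL'; apply/funext => n; apply: horner_inj => x.
apply/eqP; rewrite -subr_eq0; apply/eqP; move: n.
apply: pseries_eq0 => t t1; rewrite -(subrr (expR (- (x * t) / (1 - t)))).
have -> : pseries (fun n => (L n).[x] - (L' n).[x]) t =
    series (fun n => (L n).[x] * t ^+ n) - series (fun n => (L' n).[x] * t ^+ n).
  apply/funext => N; rewrite /pseries /series /= -[RHS]sumrB.
  by apply: eq_bigr => n _; rewrite mulrBl.
by apply: cvgB; [exact: gL|exact: gL'].
Qed.

End GeneratingFunction.

Theorem proposition1 (R : realType) (n : nat) :
  laguerreN1 R n =
    (n`!%:R)^-1 *: \sum_(0 <= k < n.+1) (lah n k)%:R *: (- 'X) ^+ k.
Proof.
(* Existence rules out the default value of [xget], and uniqueness identifies the family it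
   picks. *)
rewrite /laguerreN1 (xget_unique _ (@lah_poly_genfun R))// => L gL.
exact: laguerreN1_genfun_unique gL (@lah_poly_genfun R).
Qed.
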